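(* Let $k$ be a field of characteristic zero and let $DL\langle x\rangle$ be the free dual Leibniz algebra over $k$ in a single variable $x$. Then $DL\langle x\rangle$ does not satisfy any nontrivial dual Leibniz identity. That is, for every $n\ge 1$ and every nonzero element $f=f(x_1,\ldots,x_n)$ of the free dual Leibniz algebra $DL\langle x_1,\ldots,x_n\rangle$ over $k$, there exist $a_1,\ldots,a_n\in DL\langle x\rangle$ such that $f(a_1,\ldots,a_n)\neq 0$.
   Context: An algebra over a field $k$ is a $k$-vector space with a bilinear multiplication (not necessarily associative or unital). A dual Leibniz algebra (also called a Zinbiel algebra) over $k$ is an algebra $A$ over $k$ satisfying the identity $(xy)z=x(zy+yz)$ for all $x,y,z\in A$. $DL\langle x_1,\ldots,x_n\rangle$ denotes the free dual Leibniz algebra over $k$ (without unit) in the variables $x_1,\ldots,x_n$. For a dual Leibniz algebra $A$, $f\in DL\langle x_1,\ldots,x_n\rangle$ and $a_1,\ldots,a_n\in A$, $f(a_1,\ldots,a_n)$ denotes the image of $f$ under the unique algebra homomorphism $DL\langle x_1,\ldots,x_n\rangle\to A$ sending $x_i\mapsto a_i$. The algebra $A$ satisfies the identity $f=0$ if $f(a_1,\ldots,a_n)=0$ for all $a_1,\ldots,a_n\in A$; the identity is nontrivial if $f\neq 0$ in $DL\langle x_1,\ldots,x_n\rangle$. *)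

(* Defs.v *)
From HB Require Import structures.
From mathcomp Require Import all_boot all_order all_algebra.
From mathcomp Require Import generic_quotient boolp.

Set Implicit Arguments.
Unset Strict Implicit.
Unset Printing Implicit Defensive.

Import GRing.Theory.
Local Open Scope ring_scope.
Local Open Scope quotient_scope.

(* The product is not associative and has no unit, so it cannot be the
   multiplication of any of the ring structures of MathComp. *)
HB.mixin Record Lmodule_isDualLeibniz (k : fieldType) (A : Type)
    of GRing.Lmodule k A := {
  dlmul : A -> A -> A;
  dlmulDl : forall x y z : A, dlmul (x + y) z = dlmul x z + dlmul y z;
  dlmulDr : forall x y z : A, dlmul x (y + z) = dlmul x y + dlmul x z;
  dlmulZl : forall (c : k) (x y : A), dlmul (c *: x) y = c *: dlmul x y;
  dlmulZr : forall (c : k) (x y : A), dlmul x (c *: y) = c *: dlmul x y;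
  dlmulA : forall x y z : A,
    dlmul (dlmul x y) z = dlmul x (dlmul z y + dlmul y z)
}.

#[short(type="dualLeibnizType")]
HB.structure Definition DualLeibniz (k : fieldType) :=
  { A of GRing.Lmodule k A & Lmodule_isDualLeibniz k A }.

Definition dl_morphism (k : fieldType) (A B : dualLeibnizType k)
    (phi : A -> B) : Prop :=
  [/\ forall x y : A, phi (x + y) = phi x + phi y,
      forall (c : k) (x : A), phi (c *: x) = c *: phi x
    & forall x y : A, phi (dlmul x y) = dlmul (phi x) (phi y)].

(* The free dual Leibniz algebra on n generators is presented as the quotient
   of the formal expressions in n variables by the smallest congruence that
   contains the axioms of dual Leibniz algebras. *)
Inductive dl_term (k : Type) (n : nat) : Type :=
  | DLVar of 'I_n
  | DLZero
  | DLAdd of dl_term k n & dl_term k n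
  | DLScale of k & dl_term k n
  | DLMul of dl_term k n & dl_term k n.

Arguments DLVar {k n}.
Arguments DLZero {k n}.

Inductive dl_eq (k : fieldType) (n : nat) : dl_term k n -> dl_term k n -> Prop :=
  | dl_refl s : dl_eq s s
  | dl_sym s t : dl_eq s t -> dl_eq t s
  | dl_trans s t u : dl_eq s t -> dl_eq t u -> dl_eq s u
  | dl_congD s s' t t' :
      dl_eq s s' -> dl_eq t t' -> dl_eq (DLAdd s t) (DLAdd s' t')
  | dl_congZ c s s' : dl_eq s s' -> dl_eq (DLScale c s) (DLScale c s')
  | dl_congM s s' t t' :
      dl_eq s s' -> dl_eq t t' -> dl_eq (DLMul s t) (DLMul s' t')
  | dl_addA s t u : dl_eq (DLAdd s (DLAdd t u)) (DLAdd (DLAdd s t) u)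
  | dl_addC s t : dl_eq (DLAdd s t) (DLAdd t s)
  | dl_add0 s : dl_eq (DLAdd DLZero s) s
  | dl_addN s : dl_eq (DLAdd (DLScale (-1) s) s) DLZero
  | dl_scaleA b c s : dl_eq (DLScale b (DLScale c s)) (DLScale (b * c) s)
  | dl_scale1 s : dl_eq (DLScale 1 s) s
  | dl_scaleDr c s t :
      dl_eq (DLScale c (DLAdd s t)) (DLAdd (DLScale c s) (DLScale c t))
  | dl_scaleDl b c s :
      dl_eq (DLScale (b + c) s) (DLAdd (DLScale b s) (DLScale c s))
  | dl_mulDl s t u :
      dl_eq (DLMul (DLAdd s t) u) (DLAdd (DLMul s u) (DLMul t u))
  | dl_mulDr s t u :
      dl_eq (DLMul s (DLAdd t u)) (DLAdd (DLMul s t) (DLMul s u))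
  | dl_mulZl c s t : dl_eq (DLMul (DLScale c s) t) (DLScale c (DLMul s t))
  | dl_mulZr c s t : dl_eq (DLMul s (DLScale c t)) (DLScale c (DLMul s t))
  | dl_mulA s t u :
      dl_eq (DLMul (DLMul s t) u) (DLMul s (DLAdd (DLMul u t) (DLMul t u))).

HB.instance Definition _ (k : Type) (n : nat) := gen_eqMixin (dl_term k n).
HB.instance Definition _ (k : Type) (n : nat) := gen_choiceMixin (dl_term k n).

Definition dl_eqb (k : fieldType) (n : nat) : rel (dl_term k n) :=
  fun s t => `[< dl_eq s t >].

Lemma dl_eqb_refl (k : fieldType) (n : nat) : reflexive (@dl_eqb k n).
Proof. by move=> s; apply/asboolP; exact: dl_refl. Qed.

Lemma dl_eqb_sym (k : fieldType) (n : nat) : symmetric (@dl_eqb k n).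
Proof. by move=> s t; apply/asboolP/asboolP; exact: dl_sym. Qed.

Lemma dl_eqb_trans (k : fieldType) (n : nat) : transitive (@dl_eqb k n).
Proof.
move=> t s u /asboolP st /asboolP tu; apply/asboolP; exact: dl_trans st tu.
Qed.

Canonical dl_equiv (k : fieldType) (n : nat) : equiv_rel (dl_term k n) :=
  EquivRel (@dl_eqb k n) (@dl_eqb_refl k n) (@dl_eqb_sym k n)
           (@dl_eqb_trans k n).

Definition freeDL (k : fieldType) (n : nat) : Type := {eq_quot dl_equiv k n}.

HB.instance Definition _ (k : fieldType) (n : nat) :=
  Choice.on (freeDL k n).
HB.instance Definition _ (k : fieldType) (n : nat) :=
  EqQuotient.on (freeDL k n).

Definition freeDL_pi (k : fieldType) (n : nat) (s : dl_term k n) : freeDL k n :=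
  \pi_(freeDL k n) s.

Lemma freeDL_piP (k : fieldType) (n : nat) (s t : dl_term k n) :
  freeDL_pi s = freeDL_pi t <-> dl_eq s t.
Proof.
split=> [/eqmodP /asboolP //|st].
by apply/eqmodP/asboolP.
Qed.

Lemma freeDL_reprK (k : fieldType) (n : nat) (f : freeDL k n) :
  freeDL_pi (repr f) = f.
Proof. exact: reprK. Qed.

Lemma dl_eq_repr (k : fieldType) (n : nat) (s : dl_term k n) :
  dl_eq (repr (freeDL_pi s)) s.
Proof. by apply/freeDL_piP; rewrite freeDL_reprK. Qed.

Lemma freeDL_piW (k : fieldType) (n : nat) (P : freeDL k n -> Prop) :
  (forall s, P (freeDL_pi s)) -> forall f, P f.
Proof. by move=> H f; rewrite -(freeDL_reprK f). Qed.

Definition freeDL_var (k : fieldType) (n : nat) (i : 'I_n) : freeDL k n :=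
  freeDL_pi (DLVar i).
Definition freeDL_zero (k : fieldType) (n : nat) : freeDL k n :=
  freeDL_pi DLZero.
Definition freeDL_add (k : fieldType) (n : nat) (f g : freeDL k n) :
  freeDL k n := freeDL_pi (DLAdd (repr f) (repr g)).
Definition freeDL_scale (k : fieldType) (n : nat) (c : k) (f : freeDL k n) :
  freeDL k n := freeDL_pi (DLScale c (repr f)).
Definition freeDL_opp (k : fieldType) (n : nat) (f : freeDL k n) :
  freeDL k n := freeDL_scale (-1) f.
Definition freeDL_mul (k : fieldType) (n : nat) (f g : freeDL k n) :
  freeDL k n := freeDL_pi (DLMul (repr f) (repr g)).

Lemma freeDL_piD (k : fieldType) (n : nat) (s t : dl_term k n) :
  freeDL_add (freeDL_pi s) (freeDL_pi t) = freeDL_pi (DLAdd s t).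
Proof. by apply/freeDL_piP/dl_congD; exact: dl_eq_repr. Qed.

Lemma freeDL_piZ (k : fieldType) (n : nat) (c : k) (s : dl_term k n) :
  freeDL_scale c (freeDL_pi s) = freeDL_pi (DLScale c s).
Proof. by apply/freeDL_piP/dl_congZ; exact: dl_eq_repr. Qed.

Lemma freeDL_piM (k : fieldType) (n : nat) (s t : dl_term k n) :
  freeDL_mul (freeDL_pi s) (freeDL_pi t) = freeDL_pi (DLMul s t).
Proof. by apply/freeDL_piP/dl_congM; exact: dl_eq_repr. Qed.

Definition freeDL_piE := (freeDL_piD, freeDL_piZ, freeDL_piM).

Lemma freeDL_addA (k : fieldType) (n : nat) : associative (@freeDL_add k n).
Proof.
elim/freeDL_piW=> s; elim/freeDL_piW=> t; elim/freeDL_piW=> u.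
by rewrite !freeDL_piE; apply/freeDL_piP; exact: dl_addA.
Qed.

Lemma freeDL_addC (k : fieldType) (n : nat) : commutative (@freeDL_add k n).
Proof.
elim/freeDL_piW=> s; elim/freeDL_piW=> t.
by rewrite !freeDL_piE; apply/freeDL_piP; exact: dl_addC.
Qed.

Lemma freeDL_add0 (k : fieldType) (n : nat) :
  left_id (@freeDL_zero k n) (@freeDL_add k n).
Proof.
elim/freeDL_piW=> s.
by rewrite !freeDL_piE; apply/freeDL_piP; exact: dl_add0.
Qed.

Lemma freeDL_addN (k : fieldType) (n : nat) :
  left_inverse (@freeDL_zero k n) (@freeDL_opp k n) (@freeDL_add k n).
Proof.
elim/freeDL_piW=> s; rewrite /freeDL_opp.
by rewrite !freeDL_piE; apply/freeDL_piP; exact: dl_addN.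
Qed.

HB.instance Definition _ (k : fieldType) (n : nat) :=
  GRing.isZmodule.Build (freeDL k n)
    (@freeDL_addA k n) (@freeDL_addC k n) (@freeDL_add0 k n) (@freeDL_addN k n).

Lemma freeDL_scaleA (k : fieldType) (n : nat) (b c : k) (f : freeDL k n) :
  freeDL_scale b (freeDL_scale c f) = freeDL_scale (b * c) f.
Proof.
elim/freeDL_piW: f => s.
by rewrite !freeDL_piE; apply/freeDL_piP; exact: dl_scaleA.
Qed.

Lemma freeDL_scale1 (k : fieldType) (n : nat) :
  left_id 1 (@freeDL_scale k n).
Proof.
elim/freeDL_piW=> s.
by rewrite !freeDL_piE; apply/freeDL_piP; exact: dl_scale1.
Qed.

Lemma freeDL_scaleDr (k : fieldType) (n : nat) :
  right_distributive (@freeDL_scale k n) +%R.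
Proof.
move=> c; elim/freeDL_piW=> s; elim/freeDL_piW=> t; rewrite /GRing.add /=.
by rewrite !freeDL_piE; apply/freeDL_piP; exact: dl_scaleDr.
Qed.

Lemma freeDL_scaleDl (k : fieldType) (n : nat) (f : freeDL k n) :
  {morph (@freeDL_scale k n)^~ f : b c / b + c}.
Proof.
elim/freeDL_piW: f => s b c; rewrite [in RHS]/GRing.add /=.
by rewrite !freeDL_piE; apply/freeDL_piP; exact: dl_scaleDl.
Qed.

HB.instance Definition _ (k : fieldType) (n : nat) :=
  GRing.Zmodule_isLmodule.Build k (freeDL k n)
    (@freeDL_scaleA k n) (@freeDL_scale1 k n)
    (@freeDL_scaleDr k n) (@freeDL_scaleDl k n).

Lemma freeDL_addE (k : fieldType) (n : nat) (f g : freeDL k n) :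
  f + g = freeDL_add f g.
Proof. by []. Qed.

Lemma freeDL_scaleE (k : fieldType) (n : nat) (c : k) (f : freeDL k n) :
  c *: f = freeDL_scale c f.
Proof. by []. Qed.

Lemma freeDL_mulDl (k : fieldType) (n : nat) (f g h : freeDL k n) :
  freeDL_mul (f + g) h = freeDL_mul f h + freeDL_mul g h.
Proof.
elim/freeDL_piW: f => s; elim/freeDL_piW: g => t; elim/freeDL_piW: h => u.
by rewrite !freeDL_addE !freeDL_piE; apply/freeDL_piP; exact: dl_mulDl.
Qed.

Lemma freeDL_mulDr (k : fieldType) (n : nat) (f g h : freeDL k n) :
  freeDL_mul f (g + h) = freeDL_mul f g + freeDL_mul f h.
Proof.
elim/freeDL_piW: f => s; elim/freeDL_piW: g => t; elim/freeDL_piW: h => u.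
by rewrite !freeDL_addE !freeDL_piE; apply/freeDL_piP; exact: dl_mulDr.
Qed.

Lemma freeDL_mulZl (k : fieldType) (n : nat) (c : k) (f g : freeDL k n) :
  freeDL_mul (c *: f) g = c *: freeDL_mul f g.
Proof.
elim/freeDL_piW: f => s; elim/freeDL_piW: g => t.
by rewrite !freeDL_scaleE !freeDL_piE; apply/freeDL_piP; exact: dl_mulZl.
Qed.

Lemma freeDL_mulZr (k : fieldType) (n : nat) (c : k) (f g : freeDL k n) :
  freeDL_mul f (c *: g) = c *: freeDL_mul f g.
Proof.
elim/freeDL_piW: f => s; elim/freeDL_piW: g => t.
by rewrite !freeDL_scaleE !freeDL_piE; apply/freeDL_piP; exact: dl_mulZr.
Qed.

Lemma freeDL_mulA (k : fieldType) (n : nat) (f g h : freeDL k n) :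
  freeDL_mul (freeDL_mul f g) h =
  freeDL_mul f (freeDL_mul h g + freeDL_mul g h).
Proof.
elim/freeDL_piW: f => s; elim/freeDL_piW: g => t; elim/freeDL_piW: h => u.
by rewrite !freeDL_addE !freeDL_piE; apply/freeDL_piP; exact: dl_mulA.
Qed.

HB.instance Definition _ (k : fieldType) (n : nat) :=
  Lmodule_isDualLeibniz.Build k (freeDL k n)
    (@freeDL_mulDl k n) (@freeDL_mulDr k n)
    (@freeDL_mulZl k n) (@freeDL_mulZr k n) (@freeDL_mulA k n).

Fixpoint dl_term_eval (k : fieldType) (n : nat) (A : dualLeibnizType k)
    (a : 'I_n -> A) (s : dl_term k n) : A :=
  match s with
  | DLVar i => a i
  | DLZero => 0
  | DLAdd s t => dl_term_eval a s + dl_term_eval a t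
  | DLScale c s => c *: dl_term_eval a s
  | DLMul s t => dlmul (dl_term_eval a s) (dl_term_eval a t)
  end.

(* f(a_1, ..., a_n); freeDL_eval_morphism, freeDL_eval_var and
   freeDL_eval_unique show that it is the image of f under the unique
   homomorphism freeDL k n -> A that sends x_i to a_i. *)
Definition freeDL_eval (k : fieldType) (n : nat) (A : dualLeibnizType k)
    (a : 'I_n -> A) (f : freeDL k n) : A := dl_term_eval a (repr f).

Lemma dl_term_eval_eq (k : fieldType) (n : nat) (A : dualLeibnizType k)
    (a : 'I_n -> A) (s t : dl_term k n) :
  dl_eq s t -> dl_term_eval a s = dl_term_eval a t.
Proof.
elim=> {s t} //=.
- by move=> s t u _ -> _ ->.
- by move=> s s' t t' _ -> _ ->.
- by move=> c s s' _ ->.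
- by move=> s s' t t' _ -> _ ->.
- by move=> s t u; rewrite addrA.
- by move=> s t; rewrite addrC.
- by move=> s; rewrite add0r.
- by move=> s; rewrite scaleN1r addNr.
- by move=> b c s; rewrite scalerA.
- by move=> s; rewrite scale1r.
- by move=> c s t; rewrite scalerDr.
- by move=> b c s; rewrite scalerDl.
- by move=> s t u; rewrite dlmulDl.
- by move=> s t u; rewrite dlmulDr.
- by move=> c s t; rewrite dlmulZl.
- by move=> c s t; rewrite dlmulZr.
- by move=> s t u; rewrite dlmulA.
Qed.

Lemma freeDL_eval_pi (k : fieldType) (n : nat) (A : dualLeibnizType k)
    (a : 'I_n -> A) (s : dl_term k n) :
  freeDL_eval a (freeDL_pi s) = dl_term_eval a s.
Proof. by apply: dl_term_eval_eq; exact: dl_eq_repr. Qed.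

Lemma freeDL_eval_morphism (k : fieldType) (n : nat) (A : dualLeibnizType k)
    (a : 'I_n -> A) : dl_morphism (freeDL_eval a).
Proof.
split=> [f g|c f|f g]; exact: freeDL_eval_pi.
Qed.

Lemma freeDL_eval_var (k : fieldType) (n : nat) (A : dualLeibnizType k)
    (a : 'I_n -> A) (i : 'I_n) : freeDL_eval a (freeDL_var k i) = a i.
Proof. exact: freeDL_eval_pi. Qed.

Lemma freeDL_eval_unique (k : fieldType) (n : nat) (A : dualLeibnizType k)
    (a : 'I_n -> A) (phi : freeDL k n -> A) :
  dl_morphism phi -> (forall i, phi (freeDL_var k i) = a i) ->
  phi =1 freeDL_eval a.
Proof.
move=> [phiD phiZ phiM] phi_var; elim/freeDL_piW=> s.
rewrite freeDL_eval_pi; elim: s => [i||s IHs t IHt|c s IHs|s IHs t IHt] /=.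
- exact: phi_var.
- have := phiZ 0 0; rewrite !scale0r; exact.
- by rewrite -IHs -IHt -phiD freeDL_addE freeDL_piD.
- by rewrite -IHs -phiZ freeDL_scaleE freeDL_piZ.
- by rewrite -IHs -IHt -phiM -freeDL_piM.
Qed.

(* Main.v *)
Require Import Defs.
From HB Require Import structures.
From mathcomp Require Import all_boot all_order all_algebra.
From mathcomp Require Import boolp zify ring.

(** In characteristic zero the free dual Leibniz algebra on one generator is
the space of polynomials with the product u * I(v), where I is integration
from 0: the generator is the constant 1, and the dual Leibniz identity is the
Rota-Baxter identity I(u) I(v) = I(u I(v) + v I(u)), that is, integration by
parts. The evaluation map from DL<x> onto this model is surjective
([intpoly_generated]), so an identity of DL<x> is an identity of the model, and
it suffices to show that an f which vanishes at all tuples of polynomials is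
zero ([freeDL_eval_intpoly_eq0]).

Every f is either 0 or of the form sum_i (alpha_i x_i + x_i f_i) with shorter
f_i ([freeDL_left_reduced]), and then
  f(a) = sum_i a_i g_i(a)   with   g_i(a) = alpha_i + I(f_i(a)).
If all the g_i vanish identically, then alpha_i = 0 because I(f_i(a)) has no
constant term, f_i vanishes identically because I is injective, and f = 0
follows by induction on this decomposition.

So it remains to separate the g_i ([eval_left_factor]). Replace a_{i0} by
a_{i0} + X^N for a large N. This changes f_i(a) by X^N e_i, where each
coefficient of e_i is, for N large, a rational function of N of degree at most
0 ([eval_perturb]). Integrating X^(N+j) divides by N+j+1, so I(X^N e_i) is X^N
times a polynomial whose coefficients are rational functions of N of degree
at most -1. Subtracting sum_i a_i g_i(a) = 0 from the perturbed equation and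
dividing by X^N, one gets that g_{i0}(a), which does not depend on N, has
coefficients that are rational functions of N of negative degree. A constant
with that property is zero. *)

Set Implicit Arguments.
Unset Strict Implicit.
Unset Printing Implicit Defensive.

Import GRing.Theory.
Local Open Scope ring_scope.

(** * Integration of polynomials *)

Lemma pchar0_natr_neq0 (k : fieldType) (char0 : [pchar k] =i pred0) (m : nat) :
  m.+1%:R != 0 :> k.
Proof. by move/pcharf0P: char0 => ->. Qed.

Definition integ (k : fieldType) (u : {poly k}) : {poly k} :=
  (* At i = 0 the summand is 0, since 0^-1 = 0. *)
  \poly_(i < (size u).+1) (u`_i.-1 / i%:R).

Lemma coef_integ (k : fieldType) (u : {poly k}) (i : nat) :
  (integ u)`_i = u`_i.-1 / i%:R.
Proof.
rewrite coef_poly; case: ltnP => // lt_u_i.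
by rewrite nth_default ?mul0r //; case: i lt_u_i.
Qed.

Lemma coef0_integ (k : fieldType) (u : {poly k}) : (integ u)`_0 = 0.
Proof. by rewrite coef_integ invr0 mulr0. Qed.

Lemma integD (k : fieldType) (u v : {poly k}) :
  integ (u + v) = integ u + integ v.
Proof. by apply/polyP=> i; rewrite !(coefD, coef_integ) mulrDl. Qed.

Lemma integZ (k : fieldType) (c : k) (u : {poly k}) :
  integ (c *: u) = c *: integ u.
Proof. by apply/polyP=> i; rewrite !(coefZ, coef_integ) mulrA. Qed.

Lemma deriv_integ (k : fieldType) (char0 : [pchar k] =i pred0) (u : {poly k}) :
  (integ u)^`() = u.
Proof.
apply/polyP=> i; rewrite coef_deriv coef_integ /= -[LHS]mulr_natr divfK //.
exact: pchar0_natr_neq0.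
Qed.

Lemma integ_deriv (k : fieldType) (char0 : [pchar k] =i pred0) (p : {poly k}) :
  p`_0 = 0 -> integ p^`() = p.
Proof.
move=> p0; apply/polyP=> -[|i]; first by rewrite coef0_integ.
rewrite coef_integ coef_deriv /= -[X in X / _]mulr_natr mulfK //.
exact: pchar0_natr_neq0.
Qed.

(** Integration by parts: both sides have derivative v I(u) + u I(v) and no
constant term. *)
Lemma integ_rota_baxter (k : fieldType) (char0 : [pchar k] =i pred0)
    (u v : {poly k}) :
  integ u * integ v = integ (v * integ u + u * integ v).
Proof.
rewrite -[LHS](integ_deriv char0); last first.
  by rewrite coef0M coef0_integ mul0r.
by rewrite derivM !(deriv_integ char0) addrC [in LHS]mulrC.
Qed.

(** * The polynomial model *)

(** The hypothesis on the characteristic is a parameter of the type because the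
Rota-Baxter identity, hence the instance below, depends on it. *)
Definition intpoly (k : fieldType) (char0 : [pchar k] =i pred0) : Type :=
  {poly k}.

HB.instance Definition _ (k : fieldType) (char0 : [pchar k] =i pred0) :=
  GRing.Lmodule.copy (intpoly char0) {poly k}.

Definition intpoly_mul (k : fieldType) (char0 : [pchar k] =i pred0)
  (u v : intpoly char0) : intpoly char0 := (u : {poly k}) * integ v.

Section IntpolyDL.
Variables (k : fieldType) (char0 : [pchar k] =i pred0).
Implicit Types u v w : intpoly char0.

Lemma intpoly_mulDl u v w :
  intpoly_mul (u + v) w = intpoly_mul u w + intpoly_mul v w.
Proof. exact: (@mulrDl {poly k}). Qed.

Lemma intpoly_mulDr u v w :
  intpoly_mul u (v + w) = intpoly_mul u v + intpoly_mul u w.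
Proof. by rewrite /intpoly_mul integD (@mulrDr {poly k}). Qed.

Lemma intpoly_mulZl (c : k) u v :
  intpoly_mul (c *: u) v = c *: intpoly_mul u v.
Proof. by rewrite /intpoly_mul (scalerAl c (u : {poly k})). Qed.

Lemma intpoly_mulZr (c : k) u v :
  intpoly_mul u (c *: v) = c *: intpoly_mul u v.
Proof. by rewrite /intpoly_mul integZ (scalerAr c (u : {poly k})). Qed.

Lemma intpoly_mulA u v w :
  intpoly_mul (intpoly_mul u v) w =
  intpoly_mul u (intpoly_mul w v + intpoly_mul v w).
Proof.
by rewrite /intpoly_mul -mulrA integ_rota_baxter.
Qed.

HB.instance Definition _ := Lmodule_isDualLeibniz.Build k (intpoly char0)
  intpoly_mulDl intpoly_mulDr intpoly_mulZl intpoly_mulZr intpoly_mulA.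
End IntpolyDL.

Lemma intpoly_mulE (k : fieldType) (char0 : [pchar k] =i pred0)
    (u v : intpoly char0) :
  dlmul u v = (u : {poly k}) * integ v.
Proof. by []. Qed.

(** The generator x of DL<x> corresponds to the constant polynomial 1. *)
Definition intpoly_var (k : fieldType) (char0 : [pchar k] =i pred0)
  (i : 'I_1) : intpoly char0 := (1 : {poly k}).

(** Left multiplication by the generator is I, so that X^m / m! is its m-th
iterate on 1. *)
Lemma intpoly_generated (k : fieldType) (char0 : [pchar k] =i pred0)
    (p : intpoly char0) :
  exists h : freeDL k 1, freeDL_eval (intpoly_var char0) h = p.
Proof.
have [evD evZ evM] := freeDL_eval_morphism (intpoly_var char0).
have mono m : exists h : freeDL k 1,
    freeDL_eval (intpoly_var char0) h = 'X^m :> {poly k}.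
  elim: m => [|m [h hE]].
    by exists (freeDL_var k ord0); rewrite freeDL_eval_var.
  exists (m.+1%:R *: dlmul (freeDL_var k ord0) h).
  rewrite evZ evM hE freeDL_eval_var intpoly_mulE mul1r.
  apply/polyP=> i; rewrite coefZ coef_integ !coefXn.
  case: i => [|i] /=; first by rewrite invr0 !mulr0.
  rewrite eqSS; case: eqP => [->|_]; last by rewrite mul0r mulr0.
  by rewrite mul1r divff // pchar0_natr_neq0.
rewrite -[p]coefK poly_def; elim/big_ind: _ => [|_ _ [g <-] [h <-]|i _].
- by exists 0; have := evZ 0 0; rewrite !scale0r.
- by exists (g + h).
- by have [h <-] := mono i; exists (p`_i *: h).
Qed.

(** * Left reduced form of the elements of the free algebra *)

Lemma freeDL_eval_comp (k : fieldType) (m n : nat) (B : dualLeibnizType k)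
    (b : 'I_m -> B) (a : 'I_n -> freeDL k m) (f : freeDL k n) :
  freeDL_eval b (freeDL_eval a f) =
  freeDL_eval (fun i => freeDL_eval b (a i)) f.
Proof.
have [bD bZ bM] := freeDL_eval_morphism b.
have [aD aZ aM] := freeDL_eval_morphism a.
apply: (freeDL_eval_unique (phi := fun f => freeDL_eval b (freeDL_eval a f))).
  by split=> [x y|c x|x y]; rewrite (aD, aZ, aM) (bD, bZ, bM).
by move=> i; rewrite freeDL_eval_var.
Qed.

(** This is the expansion of f in right-normed words, sorted by first letter. Its
derivations play the role of the length of f in inductions. *)
Inductive left_reduced (k : fieldType) (n : nat) : freeDL k n -> Prop :=
  | left_reduced0 : left_reduced 0
  | left_reduced_sum (alpha : 'I_n -> k) (g : 'I_n -> freeDL k n) :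
      (forall i, left_reduced (g i)) ->
      left_reduced
        (\sum_i (alpha i *: freeDL_var k i + dlmul (freeDL_var k i) (g i))).

Arguments left_reduced_sum {k n} alpha g.

Section DLmul.
Variables (k : fieldType) (A : dualLeibnizType k).
Implicit Types x y : A.

Lemma dlmul0r x : dlmul x 0 = 0.
Proof. by rewrite -(scale0r x) dlmulZr !scale0r. Qed.

Lemma dlmul0l x : dlmul 0 x = 0.
Proof. by rewrite -(scale0r x) dlmulZl !scale0r. Qed.

Lemma dlmul_suml (n : nat) (F : 'I_n -> A) x :
  dlmul (\sum_i F i) x = \sum_i dlmul (F i) x.
Proof.
exact: (big_morph (fun y => dlmul y x) (fun y z => dlmulDl y z x) (dlmul0l x)).
Qed.
End DLmul.

Section LeftReduced.
Variables (k : fieldType) (n : nat).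
Implicit Types f g : freeDL k n.

Lemma left_reduced_var (i : 'I_n) : left_reduced (freeDL_var k i).
Proof.
have -> : freeDL_var k i = \sum_j ((j == i)%:R *: freeDL_var k j +
    dlmul (freeDL_var k j) 0).
  rewrite (bigD1 i) //= eqxx scale1r dlmul0r addr0 big1 ?addr0 // => j /negPf->.
  by rewrite scale0r dlmul0r addr0.
apply: (left_reduced_sum (fun j => (j == i)%:R) (fun=> 0)) => _.
exact: left_reduced0.
Qed.

Lemma left_reducedD f g :
  left_reduced f -> left_reduced g -> left_reduced (f + g).
Proof.
move=> rf; elim: rf g => {f} [g|alpha f' rf' IH g]; first by rewrite add0r.
case=> [|beta g' rg']; first by rewrite addr0; exact: left_reduced_sum.
rewrite -big_split /=.
under eq_bigr => i _ do rewrite addrACA -scalerDl -dlmulDr.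
by apply: (left_reduced_sum (fun i => alpha i + beta i)
  (fun i => f' i + g' i)) => i; exact: IH.
Qed.

Lemma left_reducedZ (c : k) f : left_reduced f -> left_reduced (c *: f).
Proof.
elim=> {f} [|alpha f' _ IH]; first by rewrite scaler0; exact: left_reduced0.
rewrite scaler_sumr.
under eq_bigr => i _ do rewrite scalerDr scalerA -dlmulZr.
exact: (left_reduced_sum (fun i => c * alpha i) (fun i => c *: f' i)).
Qed.

(** The dual Leibniz identity (x f') g = x (g f' + f' g) keeps the first letter
of the left factor and calls for both orders of the product of the tail f'
with g. *)
Lemma dlmul_left_reduced (alpha : 'I_n -> k) (f' : 'I_n -> freeDL k n) g :
  left_reduced g ->
  (forall i, left_reduced (dlmul (f' i) g) /\ left_reduced (dlmul g (f' i))) ->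
  left_reduced (dlmul
    (\sum_i (alpha i *: freeDL_var k i + dlmul (freeDL_var k i) (f' i))) g).
Proof.
move=> rg rfg; rewrite dlmul_suml.
rewrite [X in left_reduced X](_ : _ = \sum_i (0 *: freeDL_var k i +
    dlmul (freeDL_var k i) (alpha i *: g + (dlmul g (f' i) + dlmul (f' i) g)))).
  apply: (left_reduced_sum (fun=> 0)
    (fun i => alpha i *: g + (dlmul g (f' i) + dlmul (f' i) g))) => i.
  have [? ?] := rfg i.
  by do 2?[apply: left_reducedD => //]; exact: left_reducedZ.
apply: eq_bigr => i _.
by rewrite dlmulDl dlmulZl dlmulA scale0r add0r [RHS]dlmulDr dlmulZr.
Qed.

(** Both orders of the product are handled together, by an induction on f and,
inside it, on g, because either product brings in both orders for the tails. *)
Lemma left_reducedM f g :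
  left_reduced f -> left_reduced g -> left_reduced (dlmul f g).
Proof.
move=> rf rg; suff [] : left_reduced (dlmul f g) /\ left_reduced (dlmul g f).
  by [].
elim: rf g rg => {f} [g _|alpha f' rf' IHf g].
  by rewrite dlmul0l dlmul0r; split; exact: left_reduced0.
have rf := left_reduced_sum alpha f' rf'.
elim=> {g} [|beta g' rg' IHg].
  by rewrite dlmul0l dlmul0r; split; exact: left_reduced0.
have rg := left_reduced_sum beta g' rg'.
split; apply: dlmul_left_reduced => // i; first exact: IHf.
by have [] := IHg i.
Qed.

Lemma freeDL_left_reduced f : left_reduced f.
Proof.
elim/freeDL_piW: f; elim=> [i||s IHs t IHt|c s IHs|s IHs t IHt].
- exact: left_reduced_var.
- exact: left_reduced0.
- by rewrite -freeDL_piD; exact: left_reducedD.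
- by rewrite -freeDL_piZ; exact: left_reducedZ.
- by rewrite -freeDL_piM; exact: left_reducedM.
Qed.
End LeftReduced.

(** * Functions of N that are eventually rational *)

(** Eventually phi(N) = p(N) / q(N) with deg p + d <= deg q: an algebraic form
of phi = O(N^-d) that makes sense over any field. *)
Definition decays (k : fieldType) (d : nat) (phi : nat -> k) : Prop :=
  exists p q : {poly k}, exists M : nat,
    [/\ q != 0, (size p + d <= size q)%N
      & forall N : nat, (M <= N)%N -> q.[N%:R] * phi N = p.[N%:R]].

Section Decays.
Variable k : fieldType.
Implicit Types phi psi : nat -> k.

Lemma decays_eventually0 d phi M :
  (forall N, (M <= N)%N -> phi N = 0) -> decays d phi.
Proof.
move=> phi0; exists 0, 'X^d, M; rewrite size_poly0 size_polyXn; split=> //.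
  by rewrite -size_poly_eq0 size_polyXn.
by move=> N /phi0->; rewrite mulr0 horner0.
Qed.

Lemma decays_const (c : k) : decays 0 (fun=> c).
Proof.
exists c%:P, 1, 0%N; split; rewrite ?oner_eq0 // ?addn0 ?size_poly1.
  exact: size_polyC_leq1.
by move=> N _; rewrite !hornerC mul1r.
Qed.

Lemma decaysW d phi : decays d phi -> decays 0 phi.
Proof. by case=> p [q [M [? ? ?]]]; exists p, q, M; split=> //; lia. Qed.

Lemma size_mul_gap d (p q r s : {poly k}) :
  q != 0 -> s != 0 -> (size p + d <= size q)%N -> (size r <= size s)%N ->
  (size (p * r)%R + d <= size (q * s)%R)%N.
Proof.
move=> qn0 sn0 spq srs; rewrite (size_mul qn0 sn0).
have := size_polyMleq p r; have : (0 < size s)%N by rewrite size_poly_gt0.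
move: spq srs.
move: (size (p * r)) (size p) (size r) (size s) (size q) => *; lia.
Qed.

Lemma decaysD d phi psi :
  decays d phi -> decays d psi -> decays d (fun N => phi N + psi N).
Proof.
move=> [p1 [q1 [M1 [q1n0 s1 E1]]]] [p2 [q2 [M2 [q2n0 s2 E2]]]].
exists (p1 * q2 + p2 * q1), (q1 * q2), (maxn M1 M2).
split; first by rewrite mulf_neq0.
  rewrite (leq_trans (leq_add (size_polyD _ _) (leqnn d))) // addn_maxl geq_max.
  by rewrite size_mul_gap // [q1 * q2]mulrC size_mul_gap.
move=> N; rewrite geq_max => /andP[/E1 e1 /E2 e2].
rewrite hornerD !hornerM -e1 -e2; ring.
Qed.

Lemma decaysM d phi psi :
  decays d phi -> decays 0 psi -> decays d (fun N => phi N * psi N).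
Proof.
move=> [p1 [q1 [M1 [q1n0 s1 E1]]]] [p2 [q2 [M2 [q2n0 s2 E2]]]].
exists (p1 * p2), (q1 * q2), (maxn M1 M2).
split; first by rewrite mulf_neq0.
  by apply: size_mul_gap; rewrite // -[size p2]addn0.
move=> N; rewrite geq_max => /andP[/E1 e1 /E2 e2].
rewrite !hornerM -e1 -e2; ring.
Qed.

Lemma decays_sum d (I : Type) (r : seq I) (F : I -> nat -> k) :
  (forall i, decays d (F i)) -> decays d (fun N => \sum_(i <- r) F i N).
Proof.
move=> dF; elim: r => [|i r IH].
  by apply: (@decays_eventually0 _ _ 0%N) => N _; rewrite big_nil.
under eq_fun do rewrite big_cons.
exact: decaysD.
Qed.

Hypothesis char0 : [pchar k] =i pred0.

Lemma decays_inv (j : nat) : decays 1 (fun N => (N + j)%:R^-1 : k).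
Proof.
exists 1, ('X + j%:R%:P), 1%N; rewrite size_XaddC size_poly1; split=> //.
  by rewrite -size_poly_eq0 size_XaddC.
move=> [//|N] _; rewrite hornerD hornerX !hornerC -natrD divff //.
exact: pchar0_natr_neq0.
Qed.

(** If q c - p has infinitely many roots then it is zero, whereas for c <> 0 its
degree is that of q. *)
Lemma decays1_const (c : k) : decays 1 (fun=> c) -> c = 0.
Proof.
case=> p [q [M [qn0 spq E]]]; apply/eqP/negPn/negP => cn0.
have natr_inj : injective (fun N : nat => N%:R : k).
  have lt_neq m n : (m < n)%N -> m%:R != n%:R :> k.
    move=> /subnKC <-; rewrite addSnnS natrD -subr_eq0 opprD addrA subrr sub0r.
    by rewrite oppr_eq0 pchar0_natr_neq0.
  move=> m n /eqP.
  by case: (ltngtP m n) => // /lt_neq; rewrite 1?eq_sym => /negPf->.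
have : c *: q - p = 0.
  set r := c *: q - p.
  apply: (@roots_geq_poly_eq0 _ r [seq N%:R | N <- iota M (size r)]).
  - apply/allP=> _ /mapP[N + ->]; rewrite mem_iota => /andP[leMN _].
    by rewrite rootE hornerD hornerN hornerZ -(E _ leMN) mulrC subrr.
  - by rewrite map_inj_uniq ?iota_uniq.
  - by rewrite size_map size_iota.
move/subr0_eq => qp; by move: spq; rewrite -qp size_scale // addn1 ltnn.
Qed.
End Decays.

(** Decay is asked of each coefficient separately, with no uniformity in j. This
is why X^N decays to all orders. *)
Definition coef_decays (k : fieldType) (d : nat) (e : nat -> {poly k}) : Prop :=
  forall j, decays d (fun N => (e N)`_j).

Section CoefDecays.
Variable k : fieldType.
Implicit Types e : nat -> {poly k}.

Lemma coef_decays_const (p : {poly k}) : coef_decays 0 (fun=> p).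
Proof. by move=> j; exact: decays_const. Qed.

Lemma coef_decays_Xn d : coef_decays d (fun N => 'X^N : {poly k}).
Proof.
move=> j; apply: (@decays_eventually0 _ _ _ j.+1) => N lt_jN.
by rewrite coefXn ltn_eqF.
Qed.

Lemma coef_decaysW d e : coef_decays d e -> coef_decays 0 e.
Proof. by move=> de j; exact: decaysW (de j). Qed.

Lemma coef_decaysD d e1 e2 :
  coef_decays d e1 -> coef_decays d e2 -> coef_decays d (fun N => e1 N + e2 N).
Proof.
by move=> d1 d2 j; under eq_fun do rewrite coefD; exact: decaysD.
Qed.

Lemma coef_decaysM d e1 e2 :
  coef_decays d e1 -> coef_decays 0 e2 -> coef_decays d (fun N => e1 N * e2 N).
Proof.
move=> d1 d2 j; under eq_fun do rewrite coefM.
by apply: decays_sum => i; exact: decaysM.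
Qed.

Lemma coef_decays_sum d (n : nat) (F : 'I_n -> nat -> {poly k}) :
  (forall i, coef_decays d (F i)) ->
  coef_decays d (fun N => \sum_i F i N).
Proof.
move=> dF j; under eq_fun do rewrite coef_sum.
by apply: decays_sum => i; exact: dF.
Qed.

(** The conjugate of I by X^N, that is, X^-N I(X^N e). *)
Definition integ_shift (N : nat) (e : {poly k}) : {poly k} :=
  \poly_(j < (size e).+1) (if j is j'.+1 then e`_j' / (N + j)%:R else 0).

Lemma coef_integ_shift (N : nat) (e : {poly k}) (j : nat) :
  (integ_shift N e)`_j = if j is j'.+1 then e`_j' / (N + j)%:R else 0.
Proof.
rewrite coef_poly; case: ltnP => // lt_e_j.
by case: j lt_e_j => // j lt_e_j; rewrite nth_default ?mul0r.
Qed.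

Lemma integ_XnM (N : nat) (e : {poly k}) :
  integ ('X^N * e) = 'X^N * integ_shift N e.
Proof.
apply/polyP=> i; rewrite coef_integ !coefXnM coef_integ_shift.
case: (ltngtP i N) => [ltiN|ltNi|->].
- by rewrite (leq_ltn_trans (leq_pred i) ltiN) mul0r.
- have [j ->] : exists j, i = (N + j.+1)%N by exists (i - N.+1)%N; lia.
  by rewrite addKn addnS /= ltnNge leq_addr addKn.
- rewrite subnn; case: N => [|N] /=; first by rewrite invr0 mulr0.
  by rewrite ltnSn mul0r.
Qed.

Hypothesis char0 : [pchar k] =i pred0.

(** The gain of one order that drives the proof: integrating X^(N+j) divides by
N+j+1. *)
Lemma coef_decays_integ_shift e :
  coef_decays 0 e -> coef_decays 1 (fun N => integ_shift N (e N)).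
Proof.
move=> de [|j]; under eq_fun do rewrite coef_integ_shift.
  by apply: (@decays_eventually0 _ _ _ 0%N).
under eq_fun do rewrite mulrC.
by apply: decaysM (de j); exact: decays_inv.
Qed.
End CoefDecays.

(** * Perturbation by a high power of X *)

Section Perturbation.
Variables (k : fieldType) (char0 : [pchar k] =i pred0) (n : nat).
Notation A := (intpoly char0).
Implicit Types a : 'I_n -> A.

Definition perturb a (i0 : 'I_n) (N : nat) : 'I_n -> A :=
  fun i => (a i : {poly k}) + (i == i0)%:R * 'X^N.

(** Induction on terms. Only a product is not immediate: it expands as
(u + X^N e) (I(v) + X^N J(e')) where J is [integ_shift N]. *)
Lemma eval_perturb a (i0 : 'I_n) (f : freeDL k n) :
  exists2 e : nat -> {poly k}, coef_decays 0 e &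
  forall N, freeDL_eval (perturb a i0 N) f =
            (freeDL_eval a f : {poly k}) + 'X^N * e N :> {poly k}.
Proof.
elim/freeDL_piW: f => s.
suff [e de E] : exists2 e : nat -> {poly k}, coef_decays 0 e &
  forall N, dl_term_eval (perturb a i0 N) s =
            (dl_term_eval a s : {poly k}) + 'X^N * e N :> {poly k}.
  by exists e => // N; rewrite !freeDL_eval_pi.
elim: s => [i||s [e de E] t [e' de' E']|c s [e de E]|s [e de E] t [e' de' E']].
- exists (fun=> (i == i0)%:R); first exact: coef_decays_const.
  by move=> N; rewrite [_ * (_ == _)%:R]mulrC.
- exists (fun=> 0); first exact: coef_decays_const.
  by move=> N; rewrite mulr0 addr0.
- exists (fun N => e N + e' N); first exact: coef_decaysD.
  by move=> N; rewrite /= E E' mulrDr; exact: (@addrACA {poly k}).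
- exists (fun N => c%:P * e N).
    by apply: coef_decaysM => //; exact: coef_decays_const.
  move=> N; rewrite /= E; etransitivity; first exact: (@scalerDr k {poly k}).
  by rewrite -mul_polyC; congr (_ + _); rewrite -mul_polyC mulrCA.
- exists (fun N => e N * integ (dl_term_eval a t)
    + integ_shift N (e' N) * ((dl_term_eval a s : {poly k}) + 'X^N * e N)).
    have dJ := coef_decaysW (coef_decays_integ_shift char0 de').
    apply: coef_decaysD; apply: coef_decaysM => //.
      exact: coef_decays_const.
    apply: coef_decaysD; first exact: coef_decays_const.
    by apply: coef_decaysM => //; exact: coef_decays_Xn.
  move=> N; rewrite /= !intpoly_mulE E E' integD integ_XnM; ring.
Qed.

(** Comparing the hypothesis at a and at a + X^N in position i0 isolates
g i0 up to an error that decays in N, while g i0 does not depend on N. *)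
Lemma eval_left_factor (alpha : 'I_n -> k) (f : 'I_n -> freeDL k n) :
  (forall a : 'I_n -> A,
     \sum_i (a i : {poly k}) * ((alpha i)%:P + integ (freeDL_eval a (f i)))
       = 0 :> {poly k}) ->
  forall a i, (alpha i)%:P + integ (freeDL_eval a (f i)) = 0 :> {poly k}.
Proof.
move=> f0 a i0; set g := fun i => (alpha i)%:P + integ (freeDL_eval a (f i)).
have /choice [e eP] : forall i, exists e : nat -> {poly k}, coef_decays 0 e /\
    forall N, freeDL_eval (perturb a i0 N) (f i) =
            (freeDL_eval a (f i) : {poly k}) + 'X^N * e N :> {poly k}.
  by move=> i; have [e ? ?] := eval_perturb a i0 (f i); exists e.
pose err N := \sum_i (a i : {poly k}) * integ_shift N (e i N)
              + 'X^N * integ_shift N (e i0 N).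
have gE N : g i0 = - err N.
  apply/eqP; rewrite -addr_eq0; apply/eqP.
  apply: (mulfI (_ : 'X^N != 0)); first by rewrite -size_poly_eq0 size_polyXn.
  rewrite mulr0 -[RHS](f0 (perturb a i0 N)).
  (* Expand the perturbed equation: the terms a_i g_i sum to 0 and the rest is
     divisible by X^N. *)
  under [RHS]eq_bigr => i _.
    rewrite (eP i).2 integD integ_XnM addrA -/(g i) /perturb mulrDl mulrDr.
    over.
  rewrite !big_split /= [X in _ = X + _ + _]f0 add0r.
  rewrite [X in _ = _ + X](bigD1 i0) //= eqxx mul1r.
  rewrite [X in _ = _ + (_ + X)]big1 => [|i /negPf->]; last by rewrite !mul0r.
  rewrite addr0 /err !mulrDr mulr_sumr addrCA.
  by congr (_ + (_ + _)); apply: eq_bigr => i _; rewrite mulrCA.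
have derr : coef_decays 1 (fun N => err N).
  apply: coef_decaysD.
    apply: coef_decays_sum => i; under eq_fun do rewrite mulrC.
    apply: coef_decaysM; last exact: coef_decays_const.
    by apply: coef_decays_integ_shift => //; case: (eP i).
  apply: coef_decaysM; first exact: coef_decays_Xn.
  by apply: coef_decaysW; apply: coef_decays_integ_shift => //; case: (eP i0).
apply/polyP=> j; rewrite coef0; apply: (decays1_const char0).
have [p [q [M [qn0 spq E]]]] := derr j.
exists (- p), q, M; split; rewrite ?size_polyN // => N leMN.
by rewrite -/(g i0) (gE N) coefN mulrN E // hornerN.
Qed.

(** No nonzero element of the free algebra is an identity of the polynomial
model. *)
Lemma freeDL_eval_intpoly_eq0 (f : freeDL k n) :
  (forall a : 'I_n -> A, freeDL_eval a f = 0) -> f = 0.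
Proof.
elim: (freeDL_left_reduced f) => {f} // alpha f _ IH f0.
have g0 (a : 'I_n -> A) i :
    (alpha i)%:P + integ (freeDL_eval a (f i)) = 0 :> {poly k}.
  apply: eval_left_factor => {i}a; rewrite -[RHS](f0 a).
  have [evD evZ evM] := freeDL_eval_morphism a.
  have ev0 : freeDL_eval a 0 = 0 by have := evZ 0 0; rewrite !scale0r.
  rewrite (big_morph _ evD ev0); apply: eq_bigr => i _.
  by rewrite evD evZ evM freeDL_eval_var intpoly_mulE mulrDr mulrC mul_polyC.
rewrite big1 // => i _.
have -> : alpha i = 0.
  have /polyP/(_ 0%N) := g0 (fun=> 0) i.
  by rewrite coefD coefC coef0_integ addr0 coef0.
rewrite scale0r add0r IH ?dlmul0r // => a.
rewrite -(deriv_integ char0 (freeDL_eval a (f i))).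
have -> : integ (freeDL_eval a (f i)) = - (alpha i)%:P.
  by apply/eqP; rewrite -addr_eq0 addrC g0.
by rewrite derivN derivC oppr0.
Qed.
End Perturbation.

Theorem theorem1 (k : fieldType) (char0 : [pchar k] =i pred0)
    (n : nat) (n_ge1 : (1 <= n)%N) (f : freeDL k n) (f_neq0 : f <> 0) :
  exists a : 'I_n -> freeDL k 1, freeDL_eval a f <> 0.
Proof.
apply: contrapT => no_a; apply: f_neq0.
apply: (@freeDL_eval_intpoly_eq0 k char0) => b.
have /choice [a ab] := fun i => intpoly_generated (b i).
have fa0 : freeDL_eval a f = 0 by apply: contrapT => ?; apply: no_a; exists a.
have := freeDL_eval_comp (intpoly_var char0) a f.
rewrite fa0 (_ : (fun i => freeDL_eval _ (a i)) = b); last exact/funext.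
move=> <-; have [_ evZ _] :=
  freeDL_eval_morphism (intpoly_var char0).
by have := evZ 0 0; rewrite !scale0r.
Qed.
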